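(* Let $M^3$ be a translation hypersurface of type 2 in the isotropic space $\mathbb{I}^4$, i.e. $M^3$ is parameterized by $r(u,v,w)=(u+v,\,w,\,f(u),\,g(v)+h(w))$ with $f,g,h$ smooth real functions of one variable and $f'\neq 0$. If $M^3$ is flat (its Gauss-Kronecker curvature $K$ vanishes identically), then $M^3$ is a cylindrical hypersurface with non-isotropic rulings. Furthermore, if $M^3$ has nonzero constant Gauss-Kronecker curvature, then the following occurs: $$f(u)=\lambda u^{\frac12},\qquad g(v)=\mu v^{\frac32},\qquad h(w)=\xi w^{2},$$ where $\lambda,\mu,\xi\in\mathbb{R}$ and $\lambda\mu\xi\neq 0$.
   Context: The isotropic space $\mathbb{I}^4$ is $\mathbb{R}^4$ with affine coordinates $(x_1,\dots,x_4)$ and the degenerate metric $dx_1^2+dx_2^2+dx_3^2$; lines parallel to the $x_4$-axis are isotropic, all other lines are non-isotropic. All hypersurfaces considered have a non-isotropic tangent hyperplane (not parallel to the $x_4$-axis) at each point. For a parameterized hypersurface $r$, let $[g_{ij}]$ be the matrix of the first fundamental form induced by the degenerate metric and $h_{ij}=\det(r_u,r_v,r_w,r_{ij})/\sqrt{\det g_{ij}}$, where $r_{ij}$ are the second partial derivatives of $r$. The (isotropic) Gauss-Kronecker curvature is $K=\det[h_{ij}]/\det[g_{ij}]$. For a type 2 hypersurface as in the claim (with the sign convention used here) $$K=\frac{g'f''g''h''}{(f')^3},$$ where a prime denotes the derivative with respect to the function's own variable. A hypersurface is cylindrical with non-isotropic rulings if it is generated by mutually parallel non-isotropic lines.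
   Formalization: The formulas for f, g, h hold only up to translations of u, v, w, additive constants and reflections u→−u, v→−v (e.g. f=√(u+1) also gives constant K), and are proved in that form; rulings are open pieces of lines on a patch, complete lines if f, g, h are defined on all of ℝ. *)

(* Defs.v *)
From HB Require Import structures.
From mathcomp Require Import all_boot all_order all_algebra.
From mathcomp Require Import all_classical all_reals all_analysis.
Set Implicit Arguments.
Unset Strict Implicit.
Unset Printing Implicit Defensive.
Import Order.TTheory GRing.Theory Num.Theory.
Import numFieldNormedType.Exports.
Local Open Scope classical_set_scope.
Local Open Scope ring_scope.

Section IsotropicSpace.
Context {R : realType}.

Definition open_interval (I : set R) : Prop :=
  [/\ open I, is_interval I & I !=set0].

Definition smooth_on (I : set R) (f : R -> R) : Prop :=
  forall (n : nat) (x : R), I x -> derivable (derive1n n f) x 1.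

(* The isotropic 4-space is 'rV[R]_4; the coordinate x_(k+1) has index k, so
   x_4 has index ord_max. *)

Definition iso_dot (x y : 'rV[R]_4) : R :=
  \sum_(k < 4 | k != ord_max) x 0 k * y 0 k.

(* This includes d = 0, so that a non-isotropic d is the direction of a
   non-isotropic line. *)
Definition isotropic_direction (d : 'rV[R]_4) : Prop :=
  exists c : R, d = c *: delta_mx 0 ord_max.

Definition partial (i : 'I_3) (r : 'rV[R]_3 -> 'rV[R]_4) (p : 'rV[R]_3) :
  'rV[R]_4 := 'D_(delta_mx 0 i) r p.

Definition first_form (r : 'rV[R]_3 -> 'rV[R]_4) (p : 'rV[R]_3) : 'M[R]_3 :=
  \matrix_(i < 3, j < 3) iso_dot (partial i r p) (partial j r p).

Definition second_form (r : 'rV[R]_3 -> 'rV[R]_4) (p : 'rV[R]_3) : 'M[R]_3 :=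
  \matrix_(i < 3, j < 3)
    (\det (col_mx (\matrix_(k < 3) partial k r p)
                  (partial j (partial i r) p) : 'M[R]_4)
     / Num.sqrt (\det (first_form r p))).

Definition gauss_kronecker (r : 'rV[R]_3 -> 'rV[R]_4) (p : 'rV[R]_3) : R :=
  \det (second_form r p) / \det (first_form r p).

Definition translation2 (f g h : R -> R) (p : 'rV[R]_3) : 'rV[R]_4 :=
  let u := p 0 0 in let v := p 0 1 in let w := p 0 2 in
  \row_(k < 4) [:: u + v; w; f u; g v + h w]`_k.

Definition box (I J L : set R) : set 'rV[R]_3 :=
  [set p | [/\ I (p 0 0), J (p 0 1) & L (p 0 2)]].

Definition line_piece (T : set R) (b d : 'rV[R]_4) : set 'rV[R]_4 :=
  [set b + t *: d | t in T].

(* Generated by mutually parallel non-isotropic lines. A hypersurface patch over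
   bounded parameter intervals contains no complete line, so its generators are
   open segments (or half-lines, or lines) of the parallel lines. *)
Definition cylindrical (S : set 'rV[R]_4) : Prop :=
  exists2 d : 'rV[R]_4, ~ isotropic_direction d &
  exists2 F : set (set 'rV[R]_4),
    (forall l, F l -> exists T b, open_interval T /\ l = line_piece T b d) &
    S = \bigcup_(l in F) l.

(* The same with complete lines as generators. *)
Definition complete_cylindrical (S : set 'rV[R]_4) : Prop :=
  exists2 d : 'rV[R]_4, ~ isotropic_direction d &
  exists2 F : set (set 'rV[R]_4),
    (forall l, F l -> exists b, l = line_piece setT b d) &
    S = \bigcup_(l in F) l.

End IsotropicSpace.

(* Main.v *)
Require Import Defs.
From HB Require Import structures.
From mathcomp Require Import all_boot all_order all_algebra.
From mathcomp Require Import all_classical all_reals all_analysis.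
From mathcomp Require Import ring.
Set Implicit Arguments.
Unset Strict Implicit.
Unset Printing Implicit Defensive.
Import Order.TTheory GRing.Theory Num.Theory.
Import numFieldNormedType.Exports.
Local Open Scope classical_set_scope.
Local Open Scope ring_scope.

(** The frame r_u, r_v, r_w of a type 2 hypersurface gives a diagonal second
    form, and K = f'' g' g'' h'' / |f'|^3 separates the variables.  If K = 0,
    one of f'', g' g'', h'' vanishes identically, the corresponding function
    is affine and its parameter lines are straight.  If K is a nonzero
    constant, then f''/|f'|^3 = A, g' g'' = B and h'' = C are nonzero
    constants.  The functions g'^2 and (1/f')^2 then have constant derivative,
    so g' and 1/f' are square roots of affine functions, and f, g are
    recovered without integrating a square root: up to additive constants,
    g = g'^3 / (3 B), and f is a constant multiple of 1/f'. *)

(** * Directional derivatives of maps between row vector spaces *)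

(** Along [d] only the [i]-th coordinate matters, so the two difference quotients are equal as
    functions of [t]. *)
Lemma is_derive_coord (R : realFieldType) (n : nat) (phi : R -> R)
  (p d : 'rV[R]_n) (i : 'I_n) (df : R) :
  is_derive (p 0 i) (d 0 i) phi df ->
  is_derive p d (fun q : 'rV[R]_n => phi (q 0 i)) df.
Proof.
case=> phi_d <-.
have E : (fun t : R => t^-1 *: (phi ((t *: d + p) 0 i) - phi (p 0 i))) =
    (fun t => t^-1 *: (phi (t *: d 0 i + p 0 i) - phi (p 0 i))).
  by apply/funext => t; rewrite !mxE.
by split; [rewrite /derivable E|rewrite /derive E].
Qed.

Lemma is_derive_row (R : realFieldType) (V : normedModType R) (n : nat)
  (F : V -> 'rV[R]_n) (p d : V) (D : 'rV[R]_n) :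
  (forall k, is_derive p d (fun q => F q 0 k) (D 0 k)) -> is_derive p d F D.
Proof.
move=> dF; have F_d : derivable F p d.
  by apply/derivable_mxP => i k; rewrite ord1; have [] := dF k.
split=> //; rewrite derive_mx//; apply/rowP => k; rewrite mxE.
by have [] := dF k.
Qed.

(** Only the summands in the [i]-th variable contribute. The decomposition is asked for near [p]
    only, so that the lemma also applies to partial derivatives, which are computed on the box
    alone. *)
Lemma is_derive_separable (R : realType) (m n : nat)
  (phi : 'I_m -> 'I_n -> R -> R) (F : 'rV[R]_m -> 'rV[R]_n)
  (p : 'rV[R]_m) (i : 'I_m) :
  (\forall q \near p, F q = \row_k \sum_j phi j k (q 0 j)) ->
  (forall k, derivable (phi i k) (p 0 i) 1) ->
  is_derive p (delta_mx 0 i) F (\row_k derive1 (phi i k) (p 0 i)).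
Proof.
move=> F_eq phi_d.
apply: (@near_eq_is_derive R _ _
  (fun q : 'rV[R]_m => \row_k \sum_j phi j k (q 0 j))).
  by near=> q; apply/esym; near: q.
apply: is_derive_row => k; rewrite mxE.
have -> : (fun q : 'rV[R]_m => (\row_k \sum_j phi j k (q 0 j)) 0 k)
    = \sum_(j < m) (fun q : 'rV[R]_m => phi j k (q 0 j)).
  by apply/funext => q; rewrite mxE fct_sumE.
have -> : derive1 (phi i k) (p 0 i)
    = \sum_(j < m) (if j == i then derive1 (phi i k) (p 0 i) else 0).
  by rewrite -big_mkcond big_pred1_eq.
(* The [j]-th coordinate of the direction is 0 for [j != i], and any function has derivative 0 in
   direction 0. *)
apply: is_derive_sum => j; apply: is_derive_coord; rewrite mxE eqxx /=.
case: eqP => [->|_]; last by split; [exact: derivable0|rewrite derive0].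
by split; [exact: phi_d|rewrite derive1E].
Unshelve. all: by end_near. Qed.

Lemma open_near_coord (R : realType) (n : nat) (A : set R) (p : 'rV[R]_n)
  (i : 'I_n) : open A -> A (p 0 i) -> nbhs p [set q : 'rV[R]_n | A (q 0 i)].
Proof.
move=> Aop Ap; apply: (@coord_continuous R 1 n 0 i p A).
exact: open_nbhs_nbhs.
Qed.

(** * Determinants, and the tables of the frame and its derivatives *)

Lemma det_mx22 (R : comNzRingType) (A : 'M[R]_2) :
  \det A = A 0 0 * A 1 1 - A 0 1 * A 1 0.
Proof.
rewrite (expand_det_row _ 0) big_ord_recl big_ord1 /cofactor !det_mx11 !mxE.
rewrite /= addn0 expr0 mul1r expr1 mulN1r mulrN.
by congr (_ * A _ _ - A _ _ * A _ _); apply: val_inj.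
Qed.

(** Entries are indexed by natural numbers so that concrete ones reduce by computation. *)
Lemma det_mx33 (R : comNzRingType) (a : nat -> nat -> R) :
  \det (\matrix_(i < 3, j < 3) a i j) =
    a 0%N 0%N * (a 1%N 1%N * a 2%N 2%N - a 1%N 2%N * a 2%N 1%N)
  - a 0%N 1%N * (a 1%N 0%N * a 2%N 2%N - a 1%N 2%N * a 2%N 0%N)
  + a 0%N 2%N * (a 1%N 0%N * a 2%N 1%N - a 1%N 1%N * a 2%N 0%N).
Proof.
rewrite (expand_det_row _ 0) !big_ord_recl big_ord0 /cofactor !det_mx22 !mxE.
rewrite /= /bump /= !exprS !expr0.
ring.
Qed.

(** The expansion is along the last row, which holds [r_ij] in the second form; the frame supplies
    the minors. *)
Lemma det_mx44 (R : comNzRingType) (a : nat -> nat -> R) :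
  \det (\matrix_(i < 4, j < 4) a i j) =
    \sum_(j < 4) (-1) ^+ (3 + j) * a 3%N j *
       \det (\matrix_(i < 3, k < 3) a i (bump j k)).
Proof.
rewrite (expand_det_row _ ord_max); apply: eq_bigr => j _.
rewrite /cofactor mxE mulrCA mulrA; congr (_ * \det _).
apply/matrixP => i k; rewrite !mxE /= /bump leqNgt.
by rewrite ltn_ord.
Qed.

(* The parameterization is [r p 0 k = \sum_j translation2_part j k (p 0 j)], so
   that its mixed second partial derivatives vanish. *)
Definition translation2_part (R : realType) (f g h : R -> R)
  (j : 'I_3) (k : 'I_4) : R -> R :=
  nth 0 (nth [::] [:: [:: id; cst 0; f; cst 0];
                      [:: id; cst 0; cst 0; g];
                      [:: cst 0; id; cst 0; h]] j) k.

Definition translation2_deriv (R : realType) (f g h : R -> R)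
  (i : 'I_3) (k : 'I_4) : R -> R :=
  nth 0 (nth [::] [:: [:: cst 1; cst 0; derive1 f; cst 0];
                      [:: cst 1; cst 0; cst 0; derive1 g];
                      [:: cst 0; cst 1; cst 0; derive1 h]] i) k.

Definition translation2_deriv2 (R : realType) (f g h : R -> R)
  (i : 'I_3) (k : 'I_4) : R -> R :=
  nth 0 (nth [::] [:: [:: cst 0; cst 0; derive1 (derive1 f); cst 0];
                      [:: cst 0; cst 0; cst 0; derive1 (derive1 g)];
                      [:: cst 0; cst 0; cst 0; derive1 (derive1 h)]] i) k.

Lemma sum_ord3 (V : nmodType) (F : 'I_3 -> V) : \sum_i F i = F 0 + F 1 + F 2.
Proof.
rewrite !big_ord_recl big_ord0 addr0 addrA.
by congr (_ + F _ + F _); apply: val_inj.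
Qed.

Lemma ord3P (P : 'I_3 -> Prop) : P 0 -> P 1 -> P 2 -> forall i, P i.
Proof.
move=> P0 P1 P2 [[|[|[|//]]] ltn].
- by rewrite (_ : Ordinal ltn = 0) //; apply: val_inj.
- by rewrite (_ : Ordinal ltn = 1) //; apply: val_inj.
- by rewrite (_ : Ordinal ltn = 2) //; apply: val_inj.
Qed.

Lemma iso_dotE (R : realType) (x y : 'rV[R]_4) :
  iso_dot x y =
    \sum_(k < 3) x 0 (widen_ord (leqnSn 3) k) * y 0 (widen_ord (leqnSn 3) k).
Proof.
rewrite /iso_dot big_mkcond big_ord_recr /= addr0; apply: eq_bigr => k _.
by rewrite -val_eqE /= ltn_eqF.
Qed.

(* The rows are r_u, r_v, r_w at a point where f' = a, g' = b, h' = c. *)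
Definition frame (R : realType) (a b c : R) (i k : nat) : R :=
  nth 0 (nth [::] [:: [:: 1; 0; a; 0]; [:: 1; 0; 0; b]; [:: 0; 1; 0; c]] i) k.

(** This is a Gram determinant: the frame without its fourth coordinates has determinant [a]. Hence
    the first form is nondegenerate where f' is nonzero. *)
Lemma det_first_frame (R : realType) (a b c : R) :
  \det (\matrix_(i < 3, j < 3)
     \sum_(k < 3) frame a b c i k * frame a b c j k) = a ^+ 2.
Proof.
rewrite (det_mx33 (fun i j => \sum_(k < 3) frame a b c i k * frame a b c j k)).
rewrite !big_ord_recr !big_ord0 /frame /=; ring.
Qed.

(** In the application [y] has at most one nonzero entry: f'' in the third place gets the weight g',
    while g'' or h'' in the fourth gets the weight f'. The factor g' of K comes from here. *)
Lemma det_second_frame (R : realType) (a b c : R) (y : nat -> R) :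
  \det (\matrix_(i < 4, k < 4) if (i < 3)%N then frame a b c i k else y k)
  = a * y 3%N + b * y 2%N - a * c * y 1%N - a * b * y 0%N.
Proof.
rewrite (det_mx44 (fun i k => if (i < 3)%N then frame a b c i k else y k)).
rewrite !big_ord_recr big_ord0 /=.
rewrite !(fun l => det_mx33 (fun i j =>
  if (i < 3)%N then frame a b c i (bump l j) else y (bump l j))).
by rewrite /bump /frame /=; ring.
Qed.

(** * Partial derivatives and curvature of the parameterization *)

Section Curvature.
Context {R : realType} (I J L : set R) (f g h : R -> R).
Hypotheses (I_open : open I) (J_open : open J) (L_open : open L).
Hypotheses (f_smooth : smooth_on I f) (g_smooth : smooth_on J g)
  (h_smooth : smooth_on L h).

Let r := translation2 f g h.

Let derive1_0 : derive1 (cst 0 : R -> R) = cst 0.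
Proof. by apply/funext => x; rewrite derive1E derive_cst. Qed.

Let derive1_id : derive1 (@id R) = cst 1.
Proof. by apply/funext => x; rewrite derive1E derive_id. Qed.

Let derive1_cst1 : derive1 (cst (1 : R)) = cst 0.
Proof. by apply/funext => x; rewrite derive1E derive_cst. Qed.

Lemma box_near (p : 'rV[R]_3) : box I J L p -> nbhs p (box I J L).
Proof.
case=> pI pJ pL; near=> q; split; near: q.
- exact: (open_near_coord I_open pI).
- exact: (open_near_coord J_open pJ).
- exact: (open_near_coord L_open pL).
Unshelve. all: by end_near. Qed.

Lemma is_derive_translation2 (p : 'rV[R]_3) (i : 'I_3) : box I J L p ->
  is_derive p (delta_mx 0 i) r (\row_k translation2_deriv f g h i k (p 0 i)).
Proof.
case=> pI pJ pL.
have -> : \row_k translation2_deriv f g h i k (p 0 i)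
    = \row_k derive1 (translation2_part f g h i k) (p 0 i) :> 'rV[R]_4.
  apply/rowP => k; rewrite !mxE; move: i k.
  apply: ord3P => -[[|[|[|[|//]]]] ltk];
  by rewrite /translation2_part /translation2_deriv /= ?derive1_0 ?derive1_id.
apply: is_derive_separable.
  near=> q; apply/rowP => -[[|[|[|[|//]]]] ltk];
  by rewrite !mxE sum_ord3 /translation2_part /= ?addr0 ?add0r.
move=> k; move: i k.
apply: ord3P => -[[|[|[|[|//]]]] ltk]; rewrite /translation2_part /=.
- exact: derivable_id.
- exact: derivable_cst.
- exact: (@f_smooth 0%N).
- exact: derivable_cst.
- exact: derivable_id.
- exact: derivable_cst.
- exact: derivable_cst.
- exact: (@g_smooth 0%N).
- exact: derivable_cst.
- exact: derivable_id.
- exact: derivable_cst.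
- exact: (@h_smooth 0%N).
Unshelve. all: by end_near. Qed.

Lemma partial_translation2 (p : 'rV[R]_3) (i : 'I_3) : box I J L p ->
  partial i r p = \row_k translation2_deriv f g h i k (p 0 i).
Proof. by move=> pB; have [_ <-] := is_derive_translation2 i pB. Qed.

Lemma partial2_translation2 (p : 'rV[R]_3) (i j : 'I_3) : box I J L p ->
  partial j (partial i r) p =
    if i == j then \row_k translation2_deriv2 f g h i k (p 0 i) else 0.
Proof.
(* [psi] presents the [i]-th partial as a sum of one-variable functions whose only nonzero term is
   the [i]-th, so that [is_derive_separable] applies a second time. *)
move=> pB; pose psi (l : 'I_3) (k : 'I_4) : R -> R :=
  if l == i then translation2_deriv f g h i k else cst 0.
have psi_d k : derivable (psi j k) (p 0 j) 1.
  rewrite /psi; case: (eqVneq j i) => [->|_]; last exact: derivable_cst.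
  case: pB => pI pJ pL; move: i k {psi}.
  apply: ord3P => -[[|[|[|[|//]]]] ltk]; rewrite /translation2_deriv /=.
  - exact: derivable_cst.
  - exact: derivable_cst.
  - exact: (@f_smooth 1%N).
  - exact: derivable_cst.
  - exact: derivable_cst.
  - exact: derivable_cst.
  - exact: derivable_cst.
  - exact: (@g_smooth 1%N).
  - exact: derivable_cst.
  - exact: derivable_cst.
  - exact: derivable_cst.
  - exact: (@h_smooth 1%N).
(* The formula for the first partial is known on the box; openness of the box extends it to a
   neighbourhood of [p]. *)
have r_near : \forall q \near p, partial i r q = \row_k \sum_j psi j k (q 0 j).
  near=> q; rewrite partial_translation2; last by near: q; exact: box_near.
  apply/rowP => k; rewrite !mxE (bigD1 i) //= /psi eqxx big1 ?addr0 // => l.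
  by move=> /negPf ->.
have [_] := is_derive_separable r_near psi_d.
rewrite [partial j _ _]/partial => ->; apply/rowP => k; rewrite mxE /psi eq_sym.
case: eqP => [<-|_]; rewrite mxE ?derive1_0 //.
move: i k {psi psi_d r_near}.
apply: ord3P => -[[|[|[|[|//]]]] ltk];
by rewrite /translation2_deriv /translation2_deriv2 /= ?derive1_0 ?derive1_cst1.
Unshelve. all: by end_near. Qed.

End Curvature.

(** The second form is diagonal because mixed partials vanish. The square root of f'^2 is |f'|,
    which puts |f'|^3 in the denominator; this differs from f'^3 at most by the sign of f'. *)
Lemma gauss_kronecker_translation2 (R : realType) (I J L : set R)
  (f g h : R -> R) (I_open : open I) (J_open : open J) (L_open : open L)
  (f_smooth : smooth_on I f) (g_smooth : smooth_on J g)
  (h_smooth : smooth_on L h)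
  (p : 'rV[R]_3) : box I J L p ->
  derive1 f (p 0 0) != 0 ->
  gauss_kronecker (translation2 f g h) p =
    derive1 (derive1 f) (p 0 0) *
    (derive1 g (p 0 1) * derive1 (derive1 g) (p 0 1)) *
    derive1 (derive1 h) (p 0 2) / `|derive1 f (p 0 0)| ^+ 3.
Proof.
move=> pB f'0; set r := translation2 f g h.
have TE i k : partial i r p 0 k =
    frame (derive1 f (p 0 0)) (derive1 g (p 0 1)) (derive1 h (p 0 2)) i k.
  rewrite (partial_translation2 f_smooth g_smooth h_smooth _ pB) mxE; move: i k.
  by apply: ord3P => -[[|[|[|[|//]]]] ltk].
have NE i j k : partial j (partial i r) p 0 k = if (i == j :> nat) then
    translation2_deriv2 f g h i k (p 0 i) else 0.
  rewrite (partial2_translation2 I_open J_open L_open f_smooth g_smooth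
    h_smooth _ _ pB) -val_eqE.
  by case: ifP => _; rewrite mxE.
move: f'0 TE NE; rewrite /translation2_deriv2.
set f1 : R := derive1 f _; set g1 : R := derive1 g _.
set h1 : R := derive1 h _ => f1_neq0 TE NE.
have first_formE : \det (first_form r p) = f1 ^+ 2.
  rewrite -(det_first_frame f1 g1 h1); congr (\det _).
  apply/matrixP => i j; rewrite [LHS]mxE [RHS]mxE.
  by rewrite iso_dotE; apply: eq_bigr => k _; congr (_ * _); exact: TE.
(* Numerators of the diagonal entries, read off from [det_second_frame]. *)
pose S i := nth 0 [:: g1 * derive1 (derive1 f) (p 0 0);
   f1 * derive1 (derive1 g) (p 0 1); f1 * derive1 (derive1 h) (p 0 2)] i : R.
have second_formE : second_form r p =
    \matrix_(i < 3, j < 3) if (i == j :> nat) then S i / `|f1| else 0.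
  apply/matrixP => i j; rewrite !mxE first_formE sqrtr_sqr.
  pose y k : R := if (i == j :> nat) then
    nth 0 (nth [::] [:: [:: 0; 0; derive1 (derive1 f) (p 0 0); 0];
                        [:: 0; 0; 0; derive1 (derive1 g) (p 0 1)];
                        [:: 0; 0; 0; derive1 (derive1 h) (p 0 2)]] i) k else 0.
  have -> : col_mx (\matrix_k partial k r p) (partial j (partial i r) p) =
      \matrix_(a < 4, k < 4) (if (a < 3)%N then frame f1 g1 h1 a k else y k)
      :> 'M[R]_(3 + 1).
    apply/matrixP => a k; rewrite !mxE; case: splitP => b ->.
    - by rewrite mxE TE ltn_ord.
    - rewrite ord1 NE /y; case: ifP => // _; move: i k {y}.
      by apply: ord3P => -[[|[|[|[|//]]]] ltk].
  rewrite det_second_frame /y; case: ifP => _; last first.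
    by rewrite !mulr0 !subr0 addr0 mul0r.
  by move: i {y}; apply: ord3P; rewrite /S /= !mulr0 ?subr0 ?addr0 ?add0r.
rewrite /gauss_kronecker first_formE second_formE.
rewrite (det_mx33 (fun i j => if (i == j :> nat) then S i / `|f1| else 0)).
rewrite /S /=.
have n0 : `|f1| != 0 by rewrite normr_eq0.
have E : f1 ^+ 2 = `|f1| ^+ 2 by rewrite real_normK ?num_real.
move: (derive1 (derive1 f) _) (derive1 (derive1 g) _).
move: (derive1 (derive1 h) _) => h2 f2 g2.
rewrite !(mul0r, mulr0, subr0, addr0).
(* The factor f'^2 from the two numerators [f1 * _] cancels the determinant of the first form. *)
transitivity (f1 ^+ 2 * (g1 * f2 * g2 * h2) / `|f1| ^+ 3 / f1 ^+ 2).
  by field; rewrite f1_neq0 n0.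
by rewrite E; field.
Qed.

(** * Differential equations on an interval *)

(** Every explicit antiderivative below has the shape [c * F y ^+ n], which is why factors [1 *] and
    exponents [^+ 1] are kept there. *)
Lemma is_derive_scale_exp (R : realType) (F : R -> R) (c x d : R) (n : nat) :
  is_derive x 1 F d ->
  is_derive x 1 (fun y => c * F y ^+ n) (c * (n%:R * F x ^+ n.-1 * d)).
Proof.
move=> dF; have -> : (fun y => c * F y ^+ n) = c \*: (F ^+ n).
  by apply/funext => y; rewrite /= exprfctE.
exact: is_deriveZ.
Qed.

Section Interval.
Context {R : realType} (I : set R).
Hypothesis I_itv : open_interval I.

Lemma interval_subset (a b : R) : I a -> I b -> forall x, x \in `[a, b] -> I x.
Proof.
case: I_itv => _ I_int _ Ia Ib x; rewrite in_itv /= => abx.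
exact: I_int Ia Ib _ abx.
Qed.

Lemma is_derive_continuous (F d : R -> R) (a b : R) :
  (forall x, I x -> is_derive x 1 F (d x)) -> I a -> I b ->
  {within `[a, b], continuous F}.
Proof.
move=> dF Ia Ib; apply: derivable_within_continuous => x xab.
by have [] := dF x (interval_subset Ia Ib xab).
Qed.

(** The mean value theorem applies to [F \- G] between any point and a base point, since the segment
    joining them stays in the interval. *)
Lemma eq_derive_interval (F G d : R -> R) :
  (forall x, I x -> is_derive x 1 F (d x)) ->
  (forall x, I x -> is_derive x 1 G (d x)) ->
  exists c, forall x, I x -> F x = G x + c.
Proof.
move=> dF dG; have dFG x : I x -> is_derive x 1 (F \- G) 0.
  move=> Ix; rewrite -(subrr (d x)).
  by apply: is_deriveB; [exact: dF|exact: dG].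
have cst_le x y : I x -> I y -> x <= y -> (F \- G) x = (F \- G) y.
  move=> Ix Iy xy.
  have [z zxy|z _] := @MVT_segment R (F \- G) (cst 0) x y xy _
    (is_derive_continuous dFG Ix Iy).
    by apply: dFG; apply: (interval_subset Ix Iy); exact: subset_itv_oo_cc zxy.
  by rewrite mul0r => /eqP; rewrite subr_eq0 => /eqP.
have [_ _ [x0 Ix0]] := I_itv; exists (F x0 - G x0) => x Ix.
suff : (F \- G) x = (F \- G) x0 by rewrite /= => <-; rewrite addrC subrK.
by have [xx0|/ltW xx0] := leP x x0; [|apply/esym]; exact: cst_le.
Qed.

(** The sign is given as a factor [s] so that |F| can be replaced by [s * F] in computations. *)
Lemma nonvanishing_sign (F d : R -> R) :
  (forall x, I x -> is_derive x 1 F (d x)) -> (forall x, I x -> F x != 0) ->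
  exists2 s, s = 1 \/ s = -1 & forall x, I x -> 0 < s * F x.
Proof.
move=> dF F0.
have same_sign x y : I x -> I y -> x <= y -> 0 < F x * F y.
  move=> Ix Iy xy; rewrite ltNge; apply/negP => Fxy.
  (* If the product were not positive, 0 would lie between [F x] and [F y], and [F] would vanish in
     between. *)
  have [|c cxy /eqP] := IVT (v := 0) xy (is_derive_continuous dF Ix Iy).
    rewrite ge_min le_max.
    have [Fx|Fx] := leP (F x) 0; have [Fy|Fy] := leP (F y) 0 => //=.
    - have : 0 < F x * F y by rewrite nmulr_rgt0 lt_neqAle ?F0.
      by rewrite ltNge Fxy.
    - by rewrite (ltW Fy) orbT.
    - by rewrite (ltW Fx).
    - by move: Fxy; rewrite leNgt mulr_gt0.
  by apply/negP; apply: F0; exact: interval_subset Ix Iy c cxy.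
have [_ _ [x0 Ix0]] := I_itv; exists (Num.sg (F x0)).
  have [/eqP Fx|_|_] := sgrP (F x0); [|by left|by right].
  by rewrite (negPf (F0 _ Ix0)) in Fx.
move=> x Ix; suff : 0 < F x0 * F x.
  move=> F0x; rewrite -(pmulr_rgt0 _ (_ : 0 < `|F x0|)) ?normr_gt0 ?F0 //.
  by rewrite mulrA [_ * Num.sg _]mulrC -numEsg.
by have [xx0|/ltW xx0] := leP x x0; [rewrite mulrC|]; exact: same_sign.
Qed.

Lemma affine_of_derive_cst (F : R -> R) (C : R) :
  (forall x, I x -> is_derive x 1 F C) ->
  exists c, forall x, I x -> F x = C * x + c.
Proof.
move=> dF; apply: (eq_derive_interval dF) => x _.
have := is_derive_scale_exp C 1 (is_derive_id x 1).
by rewrite expr0 !mulr1.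
Qed.

(** Factoring out the slope exhibits the zero [x0], which becomes the shift of the parameter in the
    final formulas. *)
Lemma affine_of_derive_cst_neq0 (F : R -> R) (C : R) : C != 0 ->
  (forall x, I x -> is_derive x 1 F C) ->
  exists x0, forall x, I x -> F x = C * (x - x0).
Proof.
move=> C0 /affine_of_derive_cst[c FE]; exists (- (c / C)) => x /FE ->.
by field.
Qed.

Lemma quadratic_of_derive2_cst (F F1 : R -> R) (C : R) : C != 0 ->
  (forall x, I x -> is_derive x 1 F (F1 x)) ->
  (forall x, I x -> is_derive x 1 F1 C) ->
  exists x0 c : R, forall x, I x -> F x = C / 2 * (x - x0) ^+ 2 + c.
Proof.
move=> C0 dF /(affine_of_derive_cst_neq0 C0)[x0 F1E]; exists x0.
apply: (eq_derive_interval dF) => x Ix.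
have -> : F1 x = C / 2 * (2 * (x - x0) ^+ 1 * (1 - 0)) by rewrite F1E //; field.
by apply: is_derive_scale_exp; exact: is_deriveB.
Qed.

(** Writing [E] as its absolute value times its sign separates the scale of the root from the
    half-line, on one side of [x0], that contains the interval. *)
Lemma sqrt_of_square_affine (y : R -> R) (E x0 s : R) : E != 0 ->
  s = 1 \/ s = -1 -> (forall x, I x -> 0 < s * y x) ->
  (forall x, I x -> y x ^+ 2 = E * (x - x0)) ->
  forall x, I x -> 0 < Num.sg E * (x - x0) /\
    y x = s * Num.sqrt `|E| * Num.sqrt (Num.sg E * (x - x0)).
Proof.
move=> E0 s1 ypos y2 x Ix.
have yE : y x ^+ 2 = `|E| * (Num.sg E * (x - x0)).
  by rewrite mulrA [_ * Num.sg _]mulrC -numEsg y2.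
have y0 : y x != 0 by apply: contraTneq (ypos _ Ix) => ->; rewrite mulr0 ltxx.
split.
  by rewrite -(pmulr_rgt0 _ (_ : 0 < `|E|)) ?normr_gt0 // -yE exprn_even_gt0.
rewrite -mulrA -sqrtrM // -yE sqrtr_sqr.
have -> : `|y x| = s * y x.
  rewrite -(gtr0_norm (ypos _ Ix)) normrM.
  by case: s1 => ->; rewrite ?normrN1 ?normr1 mul1r.
by case: s1 => ->; rewrite ?mul1r // !mulN1r opprK.
Qed.

(** Let s be the sign of F1 and z = 1 / F1. The equation reads z' = - A s F1. So z^2 has the
    constant derivative E = - 2 A s, and F - (2 / E) z is constant because F' = F1. *)
Lemma sqrt_of_curvature_ode (F F1 F2 : R -> R) (A : R) : A != 0 ->
  (forall x, I x -> is_derive x 1 F (F1 x)) ->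
  (forall x, I x -> is_derive x 1 F1 (F2 x)) ->
  (forall x, I x -> F1 x != 0) ->
  (forall x, I x -> F2 x / `|F1 x| ^+ 3 = A) ->
  exists la e x0 c : R, [/\ la != 0, e = 1 \/ e = -1 &
    forall x, I x -> 0 < e * (x - x0) /\
      F x = la * (e * (x - x0)) `^ (1 / 2) + c].
Proof.
move=> A0 dF dF1 F1_neq0 F2E.
have [s s1 spos] := nonvanishing_sign dF1 F1_neq0.
have ss : s ^+ 2 = 1 by case: s1 => ->; rewrite ?sqrrN expr1n.
have s0 : s != 0 by case: s1 => ->; rewrite ?oppr_eq0 oner_eq0.
(* Since |F1| = s F1 and s^2 = 1, the cube of |F1| is s F1^3. *)
have F2s x : I x -> F2 x = A * s * F1 x ^+ 3.
  move=> Ix; have N : `|F1 x| = s * F1 x.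
    rewrite -(gtr0_norm (spos _ Ix)) normrM.
    by case: s1 => ->; rewrite ?normrN1 ?normr1 mul1r.
  rewrite -(F2E _ Ix) N [RHS](_ : _ = F2 x / s ^+ 2); last first.
    by field; rewrite s0 F1_neq0.
  by rewrite ss divr1.
pose z x := (F1 x)^-1; pose E := - 2 * A * s.
have E0 : E != 0 by rewrite !mulf_neq0 // oppr_eq0 pnatr_eq0.
have dz x : I x -> is_derive x 1 z (- (F1 x) ^- 2 * F2 x).
  by move=> Ix; apply: is_deriveV; [exact: F1_neq0|exact: dF1].
have [|x0 z2E] := @affine_of_derive_cst_neq0 (fun x => 1 * z x ^+ 2) E E0.
  move=> x Ix; have -> : E = 1 * (2 * z x ^+ 1 * (- (F1 x) ^- 2 * F2 x)).
    by rewrite (F2s _ Ix) /E /z; field; rewrite F1_neq0.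
  by apply: is_derive_scale_exp; exact: dz.
have [|c FE] := @eq_derive_interval F (fun x => 2 / E * z x ^+ 1) _ dF.
  move=> x Ix; have -> : F1 x = 2 / E * (1 * z x ^+ 0 * (- (F1 x) ^- 2 * F2 x)).
    by rewrite (F2s _ Ix) /E; field; rewrite s0 A0 F1_neq0.
  by apply: is_derive_scale_exp; exact: dz.
have spos' x : I x -> 0 < s * z x.
  move=> Ix; have -> : s * z x = (s * F1 x)^-1; last by rewrite invr_gt0 spos.
  by rewrite invfM; congr (_ * _); case: s1 => ->; rewrite ?invrN invr1.
have z2E' x : I x -> z x ^+ 2 = E * (x - x0) by move=> /z2E; rewrite mul1r.
(* The coefficient combines F = (2 / E) z + c with z = s sqrt|E| sqrt(e (x - x0)), where e is the
   sign of E. *)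
exists (2 / E * (s * Num.sqrt `|E|)), (Num.sg E), x0, c; split.
- by rewrite !mulf_neq0 ?invr_eq0 ?pnatr_eq0 // gt_eqF // sqrtr_gt0 normr_gt0.
- have [E_0|E_|E_] := sgrP E; [by rewrite E_0 eqxx in E0|by left|by right].
- move=> x Ix; have [xpos zE] := sqrt_of_square_affine E0 s1 spos' z2E' Ix.
  split=> //; rewrite (FE _ Ix) expr1 zE mul1r powR12_sqrt ?ltW //.
  by rewrite !mulrA.
Qed.

(** Here F1^2 has derivative 2 B, and F1^3 has derivative 3 F1^2 F2 = 3 B F1. So F1 is the root of
    an affine function and F is F1^3 / (3 B) up to a constant. *)
Lemma powR32_of_curvature_ode (F F1 F2 : R -> R) (B : R) : B != 0 ->
  (forall x, I x -> is_derive x 1 F (F1 x)) ->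
  (forall x, I x -> is_derive x 1 F1 (F2 x)) ->
  (forall x, I x -> F1 x * F2 x = B) ->
  exists mu e x0 c : R, [/\ mu != 0, e = 1 \/ e = -1 &
    forall x, I x -> 0 < e * (x - x0) /\
      F x = mu * (e * (x - x0)) `^ (3 / 2) + c].
Proof.
move=> B0 dF dF1 F12.
have F1_neq0 x : I x -> F1 x != 0.
  by move=> Ix; apply: contra_neq B0 => F10; rewrite -(F12 _ Ix) F10 mul0r.
have [s s1 spos] := nonvanishing_sign dF1 F1_neq0.
have s0 : s != 0 by case: s1 => ->; rewrite ?oppr_eq0 oner_eq0.
pose E := 2 * B; have E0 : E != 0 by rewrite mulf_neq0 // pnatr_eq0.
have [|x0 F1sq] := @affine_of_derive_cst_neq0 (fun x => 1 * F1 x ^+ 2) E E0.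
  move=> x Ix; have -> : E = 1 * (2 * F1 x ^+ 1 * F2 x).
    by rewrite -mulrA expr1 (F12 _ Ix) mul1r.
  by apply: is_derive_scale_exp; exact: dF1.
have [|c FE] := @eq_derive_interval F (fun x => (3 * B)^-1 * F1 x ^+ 3) _ dF.
  move=> x Ix.
  have -> : F1 x = (3 * B)^-1 * (3 * F1 x ^+ 2 * F2 x).
    by rewrite expr2 -!mulrA (F12 _ Ix); field.
  by apply: is_derive_scale_exp; exact: dF1.
have F1sq' x : I x -> F1 x ^+ 2 = E * (x - x0) by move=> /F1sq; rewrite mul1r.
exists ((3 * B)^-1 * (s * Num.sqrt `|E|) ^+ 3), (Num.sg E), x0, c; split.
- apply: mulf_neq0; first by rewrite invr_eq0 mulf_neq0 ?pnatr_eq0.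
  apply: expf_neq0; rewrite mulf_neq0 //.
  by rewrite gt_eqF // sqrtr_gt0 normr_gt0.
- have [E_0|E_|E_] := sgrP E; [by rewrite E_0 eqxx in E0|by left|by right].
- move=> x Ix; have [xpos F1E] := sqrt_of_square_affine E0 s1 spos F1sq' Ix.
  split=> //; rewrite (FE _ Ix) F1E exprMn mulrA; congr (_ * _ + _).
  (* The power 3/2 is the cube of the square root. *)
  by rewrite [3 / 2]mulrC powRrM powR12_sqrt ?ltW // powR_mulrn.
Qed.

(** Which factor vanishes could depend on the point, but F1^2 has derivative 0 and is a constant c.
    If c = 0 then F1 = 0 everywhere; otherwise F1 has no zero, so F2 = 0 everywhere. *)
Lemma affine_of_derive_mul_derive2_eq0 (F F1 F2 : R -> R) :
  (forall x, I x -> is_derive x 1 F (F1 x)) ->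
  (forall x, I x -> is_derive x 1 F1 (F2 x)) ->
  (forall x, I x -> F1 x * F2 x = 0) ->
  exists a b, forall x, I x -> F x = a * x + b.
Proof.
move=> dF dF1 F12.
have [|c F1sq] := @affine_of_derive_cst (fun x => 1 * F1 x ^+ 2) 0.
  move=> x Ix; have -> : 0 = 1 * (2 * F1 x ^+ 1 * F2 x).
    by rewrite -mulrA expr1 (F12 _ Ix) !mulr0.
  by apply: is_derive_scale_exp; exact: dF1.
have [c0|c0] := eqVneq c 0.
  exists 0; apply: affine_of_derive_cst => x Ix.
  have /eqP := F1sq _ Ix; rewrite c0 mul0r mul1r addr0 sqrf_eq0 => /eqP <-.
  exact: dF.
have [|a F1E] := @affine_of_derive_cst F1 0.
  move=> x Ix; have := F12 _ Ix => /eqP.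
  rewrite mulf_eq0 => /orP[/eqP F10|/eqP <-]; last exact: dF1.
  have := F1sq _ Ix; rewrite F10 expr0n mulr0 mul0r add0r => c0'.
  by rewrite -c0' eqxx in c0.
exists a; apply: affine_of_derive_cst => x Ix.
by rewrite -[a]add0r -(mul0r x) -F1E //; exact: dF.
Qed.

End Interval.

(** * Straight parameter lines as rulings *)

Section Rulings.
Context {R : realType}.
Implicit Types (d : 'rV[R]_4) (T : set R).

Lemma nonisotropic_of_coord (d : 'rV[R]_4) (k : 'I_4) :
  k != ord_max -> d 0 k != 0 -> ~ isotropic_direction d.
Proof.
move=> k_max dk [c dE]; move: dk.
by rewrite dE !mxE eqxx (negPf k_max) mulr0 eqxx.
Qed.

(** The two assumptions on [b] give the two inclusions between the image and the union of the line
    pieces. The same family proves both conclusions, as a piece over the whole of [R] is a complete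
    line. *)
Lemma cylindrical_image (X : Type) (r b : X -> 'rV[R]_4) (D : set X) T d :
  ~ isotropic_direction d -> open_interval T ->
  (forall p, D p -> exists2 t, T t & r p = b p + t *: d) ->
  (forall p t, D p -> T t -> exists2 q, D q & r q = b p + t *: d) ->
  cylindrical (r @` D) /\ (T = setT -> complete_cylindrical (r @` D)).
Proof.
move=> d_iso T_itv r_line line_r.
pose F := [set line_piece T (b p) d | p in D].
have rE : r @` D = \bigcup_(l in F) l.
  apply/seteqP; split=> [_ [p Dp <-]|y [_ [p Dp <-] [t Tt <-]]].
    have [t Tt rp] := r_line p Dp.
    by exists (line_piece T (b p) d); [exists p|exists t].
  by have [q Dq rq] := line_r p t Dp Tt; exists q.
split=> [|T_full]; (exists d => //; exists F => // _ [p _ <-]).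
  by exists T, (b p).
by exists (b p); rewrite T_full.
Qed.

Definition point3 (u v w : R) : 'rV[R]_3 := \row_(k < 3) [:: u; v; w]`_k.

Lemma box_point3 (I J L : set R) (u v w : R) :
  I u -> J v -> L w -> box I J L (point3 u v w).
Proof. by move=> Iu Jv Lw; split; rewrite mxE. Qed.

Section Translation2.
Variables (I J L : set R) (f g h : R -> R).
Let S := translation2 f g h @` box I J L.

(** The u-lines have direction (1, 0, a, 0). The base point is the extrapolation of such a line to u
    = 0, possibly off the surface; only parameters in [I] are used. *)
Lemma cylindrical_affine1 (a c : R) : open_interval I ->
  (forall u, I u -> f u = a * u + c) ->
  cylindrical S /\ (I = setT -> complete_cylindrical S).
Proof.
move=> I_itv fE; apply: (@cylindrical_image _ _ (fun p : 'rV[R]_3 =>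
  \row_(k < 4) [:: p 0 1; p 0 2; c; g (p 0 1) + h (p 0 2)]`_k) _ _
  (\row_(k < 4) [:: 1; 0; a; 0]`_k)) => //.
- by apply: (@nonisotropic_of_coord _ 0); rewrite // mxE oner_eq0.
- move=> p [Ip _ _]; exists (p 0 0) => //; apply/rowP => -[[|[|[|[|//]]]] k_lt];
  rewrite !mxE /= ?(fE _ Ip); ring.
- move=> p t [_ Jp Lp] It.
  exists (point3 t (p 0 1) (p 0 2)); first exact: box_point3.
  by apply/rowP => -[[|[|[|[|//]]]] k_lt]; rewrite !mxE /= ?(fE _ It); ring.
Qed.

Lemma cylindrical_affine2 (a c : R) : open_interval J ->
  (forall v, J v -> g v = a * v + c) ->
  cylindrical S /\ (J = setT -> complete_cylindrical S).
Proof.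
move=> J_itv gE; apply: (@cylindrical_image _ _ (fun p : 'rV[R]_3 =>
  \row_(k < 4) [:: p 0 0; p 0 2; f (p 0 0); c + h (p 0 2)]`_k) _ _
  (\row_(k < 4) [:: 1; 0; 0; a]`_k)) => //.
- by apply: (@nonisotropic_of_coord _ 0); rewrite // mxE oner_eq0.
- move=> p [_ Jp _]; exists (p 0 1) => //; apply/rowP => -[[|[|[|[|//]]]] k_lt];
  rewrite !mxE /= ?(gE _ Jp); ring.
- move=> p t [Ip _ Lp] Jt.
  exists (point3 (p 0 0) t (p 0 2)); first exact: box_point3.
  by apply/rowP => -[[|[|[|[|//]]]] k_lt]; rewrite !mxE /= ?(gE _ Jt); ring.
Qed.

Lemma cylindrical_affine3 (a c : R) : open_interval L ->
  (forall w, L w -> h w = a * w + c) ->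
  cylindrical S /\ (L = setT -> complete_cylindrical S).
Proof.
move=> L_itv hE; apply: (@cylindrical_image _ _ (fun p : 'rV[R]_3 =>
  \row_(k < 4) [:: p 0 0 + p 0 1; 0; f (p 0 0); g (p 0 1) + c]`_k) _ _
  (\row_(k < 4) [:: 0; 1; 0; a]`_k)) => //.
(* The first coordinate of this direction is 0, so the second one is the witness. *)
- by apply: (@nonisotropic_of_coord _ 1); rewrite // mxE oner_eq0.
- move=> p [_ _ Lp]; exists (p 0 2) => //; apply/rowP => -[[|[|[|[|//]]]] k_lt];
  rewrite !mxE /= ?(hE _ Lp); ring.
- move=> p t [Ip Jp _] Lt.
  exists (point3 (p 0 0) (p 0 1) t); first exact: box_point3.
  by apply/rowP => -[[|[|[|[|//]]]] k_lt]; rewrite !mxE /= ?(hE _ Lt); ring.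
Qed.

End Translation2.
End Rulings.

(** * Separation of variables and the classification *)

Lemma smooth_is_derive (R : realType) (I : set R) (F : R -> R) (n : nat)
  (x : R) :
  smooth_on I F -> I x -> is_derive x 1 (derive1n n F) (derive1n n.+1 F x).
Proof. by move=> F_smooth Ix; split; [exact: F_smooth|rewrite /= derive1E]. Qed.

(** The variables are independent: where [a] and [b] are nonzero at fixed points, [c] has to vanish
    throughout. *)
Lemma mul3_eq0_on (R : realType) (I J L : set R) (a b c : R -> R) :
  (forall u v w, I u -> J v -> L w -> a u * b v * c w = 0) ->
  [\/ forall u, I u -> a u = 0, forall v, J v -> b v = 0
    | forall w, L w -> c w = 0].
Proof.
move=> abc0.
have [a0|/existsNP[u /not_implyP[Iu /eqP au]]] :=
  pselect (forall u, I u -> a u = 0).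
  exact: Or31.
have [b0|/existsNP[v /not_implyP[Jv /eqP bv]]] :=
  pselect (forall v, J v -> b v = 0).
  exact: Or32.
apply: Or33 => w Lw; have /eqP := abc0 _ _ _ Iu Jv Lw.
by rewrite !mulf_eq0 (negPf au) (negPf bv) => /eqP.
Qed.

(** Freezing two variables at base points leaves nonzero factors that cancel. *)
Lemma mul3_cst_on (R : realType) (I J L : set R) (a b c : R -> R) (K : R) :
  I !=set0 -> J !=set0 -> L !=set0 -> K != 0 ->
  (forall u v w, I u -> J v -> L w -> a u * b v * c w = K) ->
  exists A B C, [/\ [/\ A != 0, B != 0 & C != 0], forall u, I u -> a u = A,
    forall v, J v -> b v = B & forall w, L w -> c w = C].
Proof.
move=> [u0 Iu0] [v0 Jv0] [w0 Lw0] K0 abcK.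
have := K0; rewrite -(abcK _ _ _ Iu0 Jv0 Lw0) !mulf_eq0 !negb_or.
move=> /andP[/andP[a0 b0] c0].
exists (a u0), (b v0), (c w0); split=> [//|u Iu|v Jv|w Lw].
- apply: (mulIf b0); apply: (mulIf c0).
  by rewrite (abcK u v0 w0) // (abcK u0 v0 w0).
- apply: (mulfI a0); apply: (mulIf c0).
  by rewrite (abcK u0 v w0) // (abcK u0 v0 w0).
- apply: (mulfI (mulf_neq0 a0 b0)).
  by rewrite (abcK u0 v0 w) // (abcK u0 v0 w0).
Qed.

(** The constants of integration appear as shifts [u0], [v0], [w0] of the parameters and as additive
    constants [f0], [g0], [h0]; the signs [eu], [ev] select the half-lines on which the powers are
    taken. *)
Theorem theorem4p1 (R : realType) (I J L : set R) (f g h : R -> R)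
  (I_itv : open_interval I) (J_itv : open_interval J) (L_itv : open_interval L)
  (f_smooth : smooth_on I f) (g_smooth : smooth_on J g)
  (h_smooth : smooth_on L h)
  (f'_neq0 : forall u, I u -> derive1 f u != 0) :
  let r := translation2 f g h in
  ((forall p, box I J L p -> gauss_kronecker r p = 0) ->
     cylindrical (r @` box I J L) /\
     (I = setT -> J = setT -> L = setT ->
        complete_cylindrical (r @` box I J L))) /\
  ((exists2 K0 : R, K0 != 0 &
      forall p, box I J L p -> gauss_kronecker r p = K0) ->
   exists la mu xi : R, la * mu * xi != 0 /\
   exists eu ev u0 v0 w0 f0 g0 h0 : R,
   [/\ (eu = 1 \/ eu = -1) /\ (ev = 1 \/ ev = -1),
       forall u, I u -> 0 < eu * (u - u0) /\
         f u = la * (eu * (u - u0)) `^ (1 / 2) + f0,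
       forall v, J v -> 0 < ev * (v - v0) /\
         g v = mu * (ev * (v - v0)) `^ (3 / 2) + g0 &
       forall w, L w -> h w = xi * (w - w0) ^+ 2 + h0]).
Proof.
move=> r.
have [I_open _ I0] := I_itv; have [J_open _ J0] := J_itv.
have [L_open _ L0] := L_itv.
(* The factor g' is grouped with g'', so that each of the three factors depends on one variable. *)
have KE u v w : I u -> J v -> L w -> gauss_kronecker r (point3 u v w) =
    derive1n 2 f u / `|derive1n 1 f u| ^+ 3 * (derive1n 1 g v * derive1n 2 g v)
    * derive1n 2 h w.
  move=> Iu Jv Lw.
  have f'0 : derive1 f (point3 u v w 0 0) != 0 by rewrite mxE; exact: f'_neq0.
  rewrite (gauss_kronecker_translation2 I_open J_open L_open f_smooth g_smooth
    h_smooth (box_point3 Iu Jv Lw) f'0).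
  by rewrite !mxE [LHS]mulrAC; congr (_ * _); exact: mulrAC.
have df n u : I u -> is_derive u 1 (derive1n n f) (derive1n n.+1 f u).
  exact: smooth_is_derive.
have dg n v : J v -> is_derive v 1 (derive1n n g) (derive1n n.+1 g v).
  exact: smooth_is_derive.
have dh n w : L w -> is_derive w 1 (derive1n n h) (derive1n n.+1 h w).
  exact: smooth_is_derive.
split=> [K_eq0|[K0 K0_neq0 K_eq]].
  have [f0|g0|h0] := @mul3_eq0_on _ I J L
    (fun u => derive1n 2 f u / `|derive1n 1 f u| ^+ 3)
    (fun v => derive1n 1 g v * derive1n 2 g v) (derive1n 2 h)
    (fun u v w Iu Jv Lw => etrans (esym (KE u v w Iu Jv Lw))
      (K_eq0 _ (box_point3 Iu Jv Lw))).
  (* Multiplying f'' = 0 by f' lets the lemma for g' g'' = 0 serve here, and likewise for h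
     below. *)
  - have f''0 u : I u -> derive1n 1 f u * derive1n 2 f u = 0.
      move=> Iu; have /eqP := f0 u Iu.
      rewrite mulf_eq0 invr_eq0 expf_eq0 normr_eq0 /=.
      rewrite (negPf (f'_neq0 u Iu)) orbF.
      by move=> /eqP ->; rewrite mulr0.
    have [a [c fE]] :=
      affine_of_derive_mul_derive2_eq0 I_itv (df 0%N) (df 1%N) f''0.
    have [S_cyl S_full] := cylindrical_affine1 J L g h I_itv fE.
    by split=> // IT _ _; exact: S_full.
  - have [a [c gE]] :=
      affine_of_derive_mul_derive2_eq0 J_itv (dg 0%N) (dg 1%N) g0.
    have [S_cyl S_full] := cylindrical_affine2 I L f h J_itv gE.
    by split=> // _ JT _; exact: S_full.
  - have h''0 w : L w -> derive1n 1 h w * derive1n 2 h w = 0.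
      by move=> Lw; rewrite h0 // mulr0.
    have [a [c hE]] :=
      affine_of_derive_mul_derive2_eq0 L_itv (dh 0%N) (dh 1%N) h''0.
    have [S_cyl S_full] := cylindrical_affine3 I J f g L_itv hE.
    by split=> // _ _ LT; exact: S_full.
have [A [B [C [[A0 B0 C0] fA gB hC]]]] := @mul3_cst_on _ I J L
  (fun u => derive1n 2 f u / `|derive1n 1 f u| ^+ 3)
  (fun v => derive1n 1 g v * derive1n 2 g v) (derive1n 2 h) K0 I0 J0 L0 K0_neq0
  (fun u v w Iu Jv Lw => etrans (esym (KE u v w Iu Jv Lw))
    (K_eq _ (box_point3 Iu Jv Lw))).
have [la [eu [u0 [f0 [la0 eu1 fE]]]]] :=
  sqrt_of_curvature_ode I_itv A0 (df 0%N) (df 1%N) f'_neq0 fA.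
have [mu [ev [v0 [g0 [mu0 ev1 gE]]]]] :=
  powR32_of_curvature_ode J_itv B0 (dg 0%N) (dg 1%N) gB.
have dh' w : L w -> is_derive w 1 (derive1n 1 h) C.
  by move=> Lw; rewrite -(hC w Lw); exact: dh.
have [w0 [h0 hE]] := quadratic_of_derive2_cst L_itv C0 (dh 0%N) dh'.
exists la, mu, (C / 2); split; first by rewrite !mulf_neq0 ?invr_eq0 ?pnatr_eq0.
by exists eu, ev, u0, v0, w0, f0, g0, h0; split.
Qed.
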